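(* For all $n\geq 1$, in terms of Pell numbers $P_k$: $$B_{n}^{neobc}=\frac{21P_{4n-2}-3P_{4n-4}+6}{8},\quad C_{n}^{neobc}=\frac{15P_{4n-2}-3P_{4n-4}}{2},$$ $$R_{n}^{neobc}=\frac{9P_{4n-2}-3P_{4n-4}-10}{8},\quad CR_{n}^{neobc}=\frac{3P_{4n-2}}{2}.$$
   Context: Pell numbers: $P_0=0$, $P_1=1$, $P_k=2P_{k-1}+P_{k-2}$. A positive integer $m$ is a neo balcobalancing number if there is a positive integer $r$ (its neo balcobalancer) such that $(1+2+\cdots+(m-1))+(1+2+\cdots+m)=2[(m-1)+m+(m+1)+(m+2)+\cdots+(m+r)]$; then $r=\frac{-2m-1+\sqrt{8m^2-12m+9}}{2}$ (equivalently, $m$ is a neo balcobalancing number iff $8m^2-12m+9$ is a perfect square). $B_n^{neobc}$ denotes the $n$-th neo balcobalancing number in increasing order ($n\ge1$), $R_n^{neobc}$ its neo balcobalancer, $C_n^{neobc}=\sqrt{8(B_n^{neobc})^2-12B_n^{neobc}+9}$ and $CR_n^{neobc}=\sqrt{2(R_n^{neobc})^2+5R_n^{neobc}+2}$. *)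

(* Defs.v *)
From mathcomp Require Import all_boot all_order all_algebra.
From mathcomp Require Import boolp classical_sets reals.
Set Implicit Arguments.
Unset Strict Implicit.
Unset Printing Implicit Defensive.
Import Order.TTheory GRing.Theory Num.Theory.

Fixpoint pell (k : nat) : nat :=
  match k with
  | 0 => 0
  | k1.+1 => match k1 with
             | 0 => 1
             | k2.+1 => 2 * pell k1 + pell k2
             end
  end.

Definition neo_balcobalancer (m r : nat) : Prop :=
  [/\ 0 < m, 0 < r &
      \sum_(1 <= i < m) i + \sum_(1 <= i < m.+1) i
      = 2 * \sum_(m.-1 <= i < (m + r).+1) i].

Definition neo_balcobalancing (m : nat) : Prop :=
  exists r : nat, neo_balcobalancer m r.

Definition nth_neo_balcobalancing (n m : nat) : Prop :=
  neo_balcobalancing m /\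
  (count (fun k => `[< neo_balcobalancing k >]) (iota 0 m)).+1 = n.

(* [xget 0 A] is an element of [A], and 0 if [A] is empty. As 0 is neither a
   neo balcobalancing number nor a neo balcobalancer, the default value can
   not be confused with a genuine one. *)
Definition Bneobc (n : nat) : nat :=
  xget 0 (fun m => nth_neo_balcobalancing n m).

Definition Rneobc (n : nat) : nat :=
  xget 0 (fun r => neo_balcobalancer (Bneobc n) r).

Local Open Scope ring_scope.

Definition Cneobc (R : realType) (n : nat) : R :=
  Num.sqrt (8 * (Bneobc n)%:R ^+ 2 - 12 * (Bneobc n)%:R + 9).

Definition CRneobc (R : realType) (n : nat) : R :=
  Num.sqrt (2 * (Rneobc n)%:R ^+ 2 + 5 * (Rneobc n)%:R + 2).

(* Main.v *)
Require Import Defs.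
From mathcomp Require Import all_boot all_order all_algebra.
From mathcomp Require Import boolp classical_sets reals.
From mathcomp Require Import zify ring lra.
Import Order.TTheory GRing.Theory Num.Theory.
Local Open Scope ring_scope.

(** The defining equation reads [m^2 = (r + 2)(2m + r - 1)].  Putting
    [s = r + 2], it becomes [(m - s)^2 = s(2s - 3)]; reduction modulo 3 gives
    [s = 3a] and [m - s = 3b] with [b^2 = a(2a - 1)], so the solutions
    correspond to the square hexagonal numbers.  These are generated from
    [(a, b) = (1, 1)] by the automorphism
    [(a, b) |-> (17a + 12b - 4, 24a + 17b - 6)] (multiplication by
    [(3 + 2 sqrt 2)^2] in the associated Pell equation), and satisfy
    [2b = P_(4n-2)] and [8a = 3P_(4n-2) - P_(4n-4) + 2]. *)

Local Open Scope nat_scope.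

Lemma sum_two_triangles (m : nat) : 0 < m ->
  \sum_(1 <= i < m) i + \sum_(1 <= i < m.+1) i = m * m.
Proof.
case: m => // m _; elim: m => [|m IHm]; first by rewrite big_geq // big_nat1.
by rewrite [X in _ + X]big_nat_recr //= [X in X + _]big_nat_recr //=; lia.
Qed.

Lemma sum_consecutive (k n : nat) :
  2 * \sum_(k <= i < k + n) i + n = n * (2 * k + n).
Proof.
elim: n => [|n IHn]; first by rewrite big_geq // addn0.
by rewrite (addnS k) big_nat_recr ?leq_addr //=; lia.
Qed.

(** The window from m - 1 to m + r has r + 2 terms, and its ends add up to 2m + r - 1. *)
Lemma neo_balcobalancerE (m r : nat) : neo_balcobalancer m r <->
  [/\ 0 < m, 0 < r & m * m = r.+2 * (2 * m + r - 1)].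
Proof.
suff sumE : 0 < m -> 2 * \sum_(m.-1 <= i < (m + r).+1) i = r.+2 * (2 * m + r - 1).
  split=> -[m_gt0 r_gt0 E]; split=> //.
    by rewrite -sum_two_triangles // E sumE.
  by rewrite sum_two_triangles // E sumE.
move=> m_gt0; have := sum_consecutive m.-1 r.+2.
have -> : m.-1 + r.+2 = (m + r).+1 by lia.
have -> : 2 * m.-1 + r.+2 = (2 * m + r - 1).+1 by lia.
by rewrite mulnS; lia.
Qed.

(** Both factors [r.+2] and [2 * m + r - 1] grow strictly with r, so the choice made in [Rneobc] is
    unambiguous. *)
Lemma neo_balcobalancer_inj (m r r' : nat) :
  neo_balcobalancer m r -> neo_balcobalancer m r' -> r = r'.
Proof.
move=> /neo_balcobalancerE[m_gt0 _ E] /neo_balcobalancerE[_ _ E'].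
case: (ltngtP r r') => // lt_r; exfalso.
  have: r.+2 * (2 * m + r - 1) < r'.+2 * (2 * m + r' - 1) by apply: ltn_mul; lia.
  by rewrite -E -E' ltnn.
have: r'.+2 * (2 * m + r' - 1) < r.+2 * (2 * m + r - 1) by apply: ltn_mul; lia.
by rewrite -E -E' ltnn.
Qed.

(** Both entries stay positive, so the natural-number subtractions never truncate. *)
Fixpoint hexsq (k : nat) : nat * nat :=
  if k is k'.+1 then
    let: (a, b) := hexsq k' in (17 * a + 12 * b - 4, 24 * a + 17 * b - 6)
  else (1, 1).

Lemma hexsqP (k : nat) (a := (hexsq k).1) (b := (hexsq k).2) :
  [/\ 0 < a, 0 < b & b * b + a = 2 * (a * a)].
Proof.
rewrite {}/a {}/b; elim: k => //= k; case: (hexsq k) => a b /= [a0 b0 E].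
split; [lia | lia |].
have [a' Ea] : exists a', 17 * a + 12 * b = a' + 4 by exists (17 * a + 12 * b - 4); lia.
have [b' Eb] : exists b', 24 * a + 17 * b = b' + 6 by exists (24 * a + 17 * b - 6); lia.
rewrite Ea Eb !addnK; nia.
Qed.

Lemma hexsq_small (a b : nat) :
  0 < a < 25 -> b * b + a = 2 * (a * a) -> a = 1 /\ b = 1.
Proof.
move=> /andP[a_gt0 a_lt] E.
(* Here b^2 = a(2a - 1) <= 24 * 47 < 36^2, which leaves a finite search; the next solution is (25,
   35). *)
have b_lt : b < 36 by nia.
suff : all (fun x => all (fun y =>
    (y * y + x == 2 * (x * x)) ==> ((x == 1) && (y == 1))) (iota 0 36)) (iota 1 24).
  move=> /allP/(_ a); rewrite mem_iota => /(_ ltac:(lia))/allP/(_ b).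
  by rewrite mem_iota E eqxx => /(_ ltac:(lia))/= /andP[/eqP -> /eqP ->].
by vm_compute.
Qed.

(* For [a >= 25] the inverse automorphism stays in the positive solutions:
   the condition [12 b <= 17 a - 5] amounts to [(a - 1)(a - 25) >= 0]. *)
Lemma hexsq_complete (a b : nat) :
  0 < a -> b * b + a = 2 * (a * a) -> exists k, hexsq k = (a, b).
Proof.
elim/ltn_ind: a b => a IHa b a_gt0 E.
have [a_lt|a_ge] := ltnP a 25.
  have [-> ->] := hexsq_small _ _ (ltac:(lia) : 0 < a < 25) E.
  by exists 0.
have b_le : 12 * b + 5 <= 17 * a by nia.
(* The inverse sends (a, b) to (17a - 12b - 4, 17b - 24a + 6). This bound makes the second entry a
   natural number; the next one makes the first entry smaller than a, as the induction requires. *)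
have b_ge : 24 * a <= 17 * b + 6 by nia.
have a_lt : 16 * a < 12 * b + 4 by nia.
have [a' Ea] : exists a', 17 * a = a' + 12 * b + 4.
  by exists (17 * a - 12 * b - 4); lia.
have [b' Eb] : exists b', 17 * b + 6 = b' + 24 * a.
  by exists (17 * b + 6 - 24 * a); lia.
have E' : b' * b' + a' = 2 * (a' * a') by nia.
have [k Ek] := IHa a' ltac:(lia) b' ltac:(lia) E'.
by exists k.+1; rewrite /= Ek; congr pair; lia.
Qed.

Definition neob (k : nat) : nat := 3 * ((hexsq k).1 + (hexsq k).2).

Definition neor (k : nat) : nat := 3 * (hexsq k).1 - 2.

Lemma neo_balcobalancer_neob (k : nat) : neo_balcobalancer (neob k) (neor k).
Proof.
apply/neo_balcobalancerE; have [a_gt0 b_gt0 E] := hexsqP k.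
rewrite /neob /neor; move: a_gt0 b_gt0 E.
move: (hexsq k).1 (hexsq k).2 => a b a_gt0 b_gt0 E; split; [lia | lia |].
have -> : (3 * a - 2).+2 = 3 * a by lia.
have -> : 2 * (3 * (a + b)) + (3 * a - 2) - 1 = 3 * (3 * a + 2 * b - 1) by lia.
have [d Ed] : exists d, 3 * a + 2 * b = d.+1 by exists (3 * a + 2 * b - 1); lia.
by rewrite Ed subn1 /=; nia.
Qed.

(** The reason is that -1 is not a square modulo 3. *)
Lemma sum_squares_mod3 (s t c : nat) :
  s * s + t * t = 3 * c -> exists a b, s = 3 * a /\ t = 3 * b.
Proof.
move=> E; exists (s %/ 3), (t %/ 3).
have := divn_eq s 3; have := divn_eq t 3.
have := ltn_pmod s (isT : 0 < 3); have := ltn_pmod t (isT : 0 < 3).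
move: (s %/ 3) (t %/ 3) (s %% 3) (t %% 3) => q p u v v3 u3 Et Es.
by subst s t; case: u u3 E => [|[|[|//]]] _; case: v v3 => [|[|[|//]]] _; lia.
Qed.

Lemma neo_balcobalancingE (m : nat) :
  neo_balcobalancing m <-> exists k, m = neob k.
Proof.
split=> [[r /neo_balcobalancerE[m_gt0 r_gt0 E]]|[k ->]]; last first.
  by exists (neor k); apply: neo_balcobalancer_neob.
(* As 2m + r - 1 >= 2m, the equation even gives m >= 2(r + 2); hence t = m - s is a natural
   number. *)
have m_ge : r.+2 <= m by nia.
have [t Em] : exists t, m = r.+2 + t by exists (m - r.+2); lia.
have Et : t * t + 3 * r.+2 = 2 * (r.+2 * r.+2).
  have [d Ed] : exists d, 2 * m + r = d.+1 by exists (2 * m + r - 1); lia.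
  by move: E; rewrite Ed subn1 /= => E; nia.
have [a [b [Ea Eb]]] : exists a b, r.+2 = 3 * a /\ t = 3 * b.
  (* With s = r + 2, the relation t^2 + 3s = 2s^2 becomes s^2 + t^2 = 3s(s - 1). *)
  by apply: (@sum_squares_mod3 _ _ (r.+2 * r.+1)); lia.
rewrite Ea Eb in Et Em.
have [k Ek] := @hexsq_complete a b ltac:(lia) ltac:(nia).
by exists k; rewrite /neob Ek /=; lia.
Qed.

(** The elements of P below f k are f 0, ..., f (k - 1), so an increasing enumeration gives the rank
    of each element. *)
Lemma count_iota_increasing (P : pred nat) (f : nat -> nat) (k : nat) :
  {mono f : i j / i < j} -> (forall m, P m <-> exists i, m = f i) ->
  count P (iota 0 (f k)) = k.
Proof.
move=> f_mono PE.
have f_inj : injective f.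
  move=> i j fij; have := f_mono i j; have := f_mono j i.
  by rewrite fij ltnn; case: ltngtP.
rewrite -size_filter -[RHS](size_iota 0 k) -[RHS](size_map f).
apply/perm_size/uniq_perm.
- by rewrite filter_uniq ?iota_uniq.
- by rewrite map_inj_uniq ?iota_uniq.
move=> m; rewrite mem_filter mem_iota /= add0n.
apply/andP/mapP => [[/PE[i ->]]|[i]].
  by rewrite f_mono => lt_ik; exists i; rewrite ?mem_iota.
by rewrite mem_iota => lt_ik ->; rewrite f_mono; split=> //; apply/PE; exists i.
Qed.

Lemma neob_mono : {mono neob : i j / i < j}.
Proof.
have neob_lt : {homo neob : i j / i < j}.
  apply: homo_ltn => [|k]; first exact: ltn_trans.
  have [a_gt0 b_gt0 _] := hexsqP k; rewrite /neob /=.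
  by case: (hexsq k) a_gt0 b_gt0 => a b /= a_gt0 b_gt0; lia.
by apply: leqW_mono; apply: leq_mono.
Qed.

Lemma count_neo_balcobalancing (k : nat) :
  count (fun m => `[< neo_balcobalancing m >]) (iota 0 (neob k)) = k.
Proof.
apply: count_iota_increasing; first exact: neob_mono.
by move=> m; rewrite -neo_balcobalancingE; split=> [/asboolP|?]; last apply/asboolP.
Qed.

(** Ranks start at 1 and [neob] at index 0, whence the shift. The count below [neob j] is j, so the
    rank determines the number. *)
Lemma Bneobc_neob (k : nat) : Bneobc k.+1 = neob k.
Proof.
apply: xget_unique.
  split; last by rewrite count_neo_balcobalancing.
  by apply/neo_balcobalancingE; exists k.
move=> m [/neo_balcobalancingE[j ->]].
by rewrite count_neo_balcobalancing => -[->].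
Qed.

Lemma Rneobc_neor (k : nat) : Rneobc k.+1 = neor k.
Proof.
rewrite /Rneobc Bneobc_neob; apply: xget_unique.
  exact: neo_balcobalancer_neob.
by move=> r /neo_balcobalancer_inj; apply; apply: neo_balcobalancer_neob.
Qed.

Lemma pellSS (k : nat) : pell k.+2 = 2 * pell k.+1 + pell k.
Proof. by []. Qed.

Lemma hexsq_pell (k : nat) :
  8 * (hexsq k).1 + pell (4 * k) = 3 * pell (4 * k + 2) + 2 /\
  2 * (hexsq k).2 = pell (4 * k + 2).
Proof.
elim: k => [//|k]; have [a_gt0 b_gt0 _] := hexsqP k.
have -> : 4 * k.+1 + 2 = (4 * k).+4.+2 by lia.
have -> : 4 * k.+1 = (4 * k).+4 by lia.
have -> : 4 * k + 2 = (4 * k).+2 by lia.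
(* All Pell numbers involved are linear forms in two consecutive ones, so the induction step is
   linear arithmetic. *)
rewrite !pellSS; move: (pell (4 * k)) (pell (4 * k).+1) => p q /=.
by case: (hexsq k) a_gt0 b_gt0 => a b /= a_gt0 b_gt0; lia.
Qed.

Local Open Scope ring_scope.

Theorem theorem5p1 (R : realType) (n : nat) (hn : (1 <= n)%N) :
  [/\ (Bneobc n)%:R
        = (21 * (pell (4 * n - 2))%:R - 3 * (pell (4 * n - 4))%:R + 6) / 8 :> R,
      Cneobc R n
        = (15 * (pell (4 * n - 2))%:R - 3 * (pell (4 * n - 4))%:R) / 2,
      (Rneobc n)%:R
        = (9 * (pell (4 * n - 2))%:R - 3 * (pell (4 * n - 4))%:R - 10) / 8 :> R
    & CRneobc R n = 3 * (pell (4 * n - 2))%:R / 2].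
Proof.
case: n hn => // k _; rewrite /Cneobc /CRneobc Bneobc_neob Rneobc_neor.
have -> : (4 * k.+1 - 2 = 4 * k + 2)%N by lia.
have -> : (4 * k.+1 - 4 = 4 * k)%N by lia.
have [] := hexsqP k; have [] := hexsq_pell k; rewrite /neob /neor.
move: (hexsq k).1 (hexsq k).2 (pell (4 * k)) (pell (4 * k + 2)).
move=> a b q p Ea Eb a_gt0 b_gt0 E.
have {}Ea : 8 * a%:R + q%:R = 3 * p%:R + 2 :> R by rewrite -!natrM -!natrD Ea.
have {}Eb : 2 * b%:R = p%:R :> R by rewrite -natrM Eb.
have {}E : b%:R * b%:R + a%:R = 2 * (a%:R * a%:R) :> R.
  by rewrite -!natrM -!natrD E.
have a_ge1 : 1 <= a%:R :> R by rewrite ler1n.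
have b_ge0 : 0 <= b%:R :> R by rewrite ler0n.
rewrite natrB; last by lia.
rewrite !natrM natrD.
have Eq : q%:R = 3 * p%:R + 2 - 8 * a%:R :> R by lra.
rewrite Eq -Eb; move: a_ge1 b_ge0 E.
move: (a%:R : R) (b%:R : R) => x y x_ge1 y_ge0 E; split; [by field| |by field|].
(* The two sides differ by 36 times the relation [E]; for the other radicand the factor is 9. *)
- have -> : 8 * (3 * (x + y)) ^+ 2 - 12 * (3 * (x + y)) + 9
      = (12 * x + 6 * y - 3) ^+ 2 by lra.
  by rewrite sqrtr_sqr ger0_norm; [field | lra].
- have -> : 2 * (3 * x - 2) ^+ 2 + 5 * (3 * x - 2) + 2 = (3 * y) ^+ 2 by lra.
  by rewrite sqrtr_sqr ger0_norm; [field | lra].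
Qed.
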